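(* Let $X \subset \Sigma^{\mathbb{Z}^2}$ be an almost minimal two-dimensional subshift whose (horizontal) trace is sparse. Then $X$ is the orbit closure of a finite point, of a highway, or of a cluster fractal.
   Context: A ($\mathbb{Z}^d$-)subshift is a nonempty closed shift-invariant subset of $\Sigma^{\mathbb{Z}^d}$ (product topology), where $\sigma^{\mathbf v}(x)_{\mathbf u} = x_{\mathbf u + \mathbf v}$ and $\Sigma \ni 0$ is a finite alphabet; symbols other than $0$ are nonzero, and the support of a configuration is its set of nonzero cells. A subshift $X$ is almost minimal if its only closed shift-invariant subsets are $\emptyset$, $X$ and a single one-point set $\{y\} \neq X$; subshifts are pointed with distinguished point $0^{\mathbb{Z}^d}$, so $y = 0^{\mathbb{Z}^d}$. The (horizontal) trace of a $\mathbb{Z}^2$-subshift $X$ is the set of all $y \in \Sigma^{\mathbb{Z}}$ such that for some $x \in X$, $i \in \mathbb{Z}$, $y_j = x_{(j,i)}$ for all $j$. The trace is sparse if each of its configurations has only finitely many nonzero symbols. A finite point is a configuration with finite support. Highways. On $\mathbb{Z}^d$ use $d(\mathbf u,\mathbf v) = \max_i |\mathbf u_i - \mathbf v_i|$. An $r$-path in $\mathbb{Z}^2$ is a function $p : \mathbb{Z} \to \mathbb{Z}^2$ with $p(0) = \mathbf 0$ and $d(p(i+1),p(i)) \le r$ for all $i$. It is ascending if, writing $p'(i)$ for the second coordinate of $p(i)$, there is $m \in \mathbb{N}$ such that $p'(j+m+1) - p'(j) > 0$ for all $j \in \mathbb{Z}$. A configuration $x$ is a highway if for some $r$, some ascending $r$-path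 $p$ and some $\mathbf v \in \mathbb{Z}^2$, the support of $x$ equals $\{\mathbf v + p(i) : i \in \mathbb{Z}\}$ and the colored path $i \mapsto (p(i), x_{\mathbf v + p(i)})$ is uniformly recurrent, i.e. in the bi-infinite sequence $i \mapsto (p(i+1)-p(i), x_{\mathbf v + p(i)})$ every finite subword that occurs does so with bounded gaps. Cluster fractals. $B_r(S)$ is the set of cells at distance at most $r$ from $S$. A pattern is a function $P : D(P) \to \Sigma$ with $D(P) \subset \mathbb{Z}^d$; its support $S(P)$ is the set of cells of $D(P)$ where $P$ is nonzero. A set $S$ is $r$-connected if the graph on $S$ with edges between cells at distance at most $r$ is connected. $P$ is $r$-padded if $D(P) \supset B_r(S(P))$. An $r$-cluster is an $r$-padded pattern (with nonempty support) whose support is $r$-connected and all of whose zero cells are at distance at most $r$ from the support. $R$ is a zero-gluing of patterns $P$, $Q$ if $D(R) = D(P)\cup D(Q)$, $R|_{D(P)} = P$, $R|_{D(Q)} = Q$, and $P$, $Q$ are both $0$ on $D(P)\cap D(Q)$ (similarly for finitely many patterns). $P|_{\mathbb{Z}^d}$ is the configuration agreeing with $P$ on $D(P)$ and $0$ elsewhere. A configuration $x \in \Sigma^{\mathbb{Z}^d}$ is a cluster fractal if it is not all-zero and there are $r_1 < r_2 < \cdots$ in $\mathbb{N}$ and, for each $i$, a finite set $B_i$ of finite $r_i$-clusters such that for all $i$: (1) each cluster in $B_{i+1}$ is obtained by zero-gluing translates of clusters in $B_i$ and adding the $r_{i+1}$-padding by zeroes; (2) each cluster in $B_{i+1}$ contains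 a translate of every cluster in $B_i$; (3) each cluster in $B_{i+1}$ contains at least two translates of clusters in $B_i$ with disjoint supports; and (4) $x = \lim_{j\to\infty} \sigma^{\mathbf v_j}(b_j|_{\mathbb{Z}^d})$ for some sequences $\mathbf v_j \in \mathbb{Z}^d$, $b_j \in B_j$. *)

(* Defs.v *)
From mathcomp Require Import all_boot all_order all_algebra.
From mathcomp Require Import all_classical all_reals all_analysis.

Set Implicit Arguments.
Unset Strict Implicit.
Unset Printing Implicit Defensive.

Import Order.TTheory GRing.Theory Num.Theory.

Local Open Scope classical_set_scope.
Local Open Scope ring_scope.

(* Throughout, [Sigma] is the alphabet and [o : Sigma] is its symbol 0. *)

Definition cell : Type := (int * int)%type.

Notation config Sigma := {ptws cell -> discrete_topology Sigma}.

Definition shiftc (Sigma : finType) (v : cell) (x : config Sigma) :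
  config Sigma := fun u => x (u + v).

Definition zero_config (Sigma : finType) (o : Sigma) : config Sigma :=
  fun _ => o.

Definition csupp (Sigma : finType) (o : Sigma) (x : config Sigma) :
  set cell := [set u | x u <> o].

Definition shift_invariant (Sigma : finType) (X : set (config Sigma)) : Prop :=
  forall (v : cell) (x : config Sigma), X x -> X (shiftc v x).

Definition subshift (Sigma : finType) (X : set (config Sigma)) : Prop :=
  [/\ X !=set0, closed X & shift_invariant X].

(* Subshifts are pointed by the all-zero configuration, which is therefore the
   unique one-point subsystem allowed. *)
Definition almost_minimal (Sigma : finType) (o : Sigma)
    (X : set (config Sigma)) : Prop :=
  [/\ subshift X,
      [set zero_config o] <> X
    & forall Y : set (config Sigma),
        [/\ Y `<=` X, closed Y & shift_invariant Y] <->
        [\/ Y = set0, Y = X | Y = [set zero_config o]]].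

Definition trace (Sigma : finType) (X : set (config Sigma)) :
    set (int -> Sigma) :=
  [set y | exists x : config Sigma, X x /\
           exists i : int, forall j : int, y j = x (j, i)].

Definition sparse (Sigma : finType) (o : Sigma) (T : set (int -> Sigma)) :
    Prop :=
  forall y : int -> Sigma, T y -> finite_set [set j | y j <> o].

Definition orbit_closure (Sigma : finType) (x : config Sigma) :
    set (config Sigma) :=
  closure [set shiftc v x | v in [set: cell]].

Definition finite_point (Sigma : finType) (o : Sigma) (x : config Sigma) :
    Prop := finite_set (csupp o x).

Definition dist (u v : cell) : nat :=
  maxn (absz (u.1 - v.1)) (absz (u.2 - v.2)).

Definition rpath (r : nat) (p : int -> cell) : Prop :=
  p 0 = 0 /\ forall i : int, (dist (p (i + 1)%R) (p i) <= r)%N.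

Definition ascending (p : int -> cell) : Prop :=
  exists m : nat, forall j : int, 0 < (p (j + m%:Z + 1)).2 - (p j).2.

(* The subword of length [n] at position [i] reoccurs in every window of
   [N + 1] consecutive positions. *)
Definition uniformly_recurrent (A : Type) (s : int -> A) : Prop :=
  forall (i : int) (n : nat), exists N : nat, forall k : int,
    exists j : int, (k <= j <= k + N%:Z) /\
      forall t : nat, (t < n)%N -> s (j + t%:Z) = s (i + t%:Z).

Definition highway (Sigma : finType) (o : Sigma) (x : config Sigma) : Prop :=
  exists (r : nat) (p : int -> cell) (v : cell),
    [/\ rpath r p,
        ascending p,
        csupp o x = [set v + p i | i in [set: int]]
      & uniformly_recurrent
          (fun i : int => (p (i + 1) - p i, x (v + p i) : Sigma))].

Definition nbhd (r : nat) (S : set cell) : set cell :=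
  [set u | exists2 w, S w & (dist u w <= r)%N].

Definition rconnected (r : nat) (S : set cell) : Prop :=
  forall u v : cell, S u -> S v ->
    exists s : seq cell,
      [/\ path (fun a b => dist a b <= r)%N u s,
          last u s = v
        & forall w : cell, w \in s -> S w].

(* A partial map; [None] outside the domain D(P). *)
Definition pattern (Sigma : finType) : Type := cell -> option Sigma.

Definition pdom (Sigma : finType) (P : pattern Sigma) : set cell :=
  [set u | P u <> None].

Definition psupp (Sigma : finType) (o : Sigma) (P : pattern Sigma) :
    set cell :=
  [set u | exists2 a : Sigma, P u = Some a & a <> o].

Definition padded (Sigma : finType) (o : Sigma) (r : nat)
    (P : pattern Sigma) : Prop :=
  nbhd r (psupp o P) `<=` pdom P.

Definition rcluster (Sigma : finType) (o : Sigma) (r : nat)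
    (P : pattern Sigma) : Prop :=
  [/\ padded o r P,
      psupp o P !=set0,
      rconnected r (psupp o P)
    & forall u : cell, P u = Some o -> nbhd r (psupp o P) u].

Definition translate (Sigma : finType) (v : cell) (P : pattern Sigma) :
    pattern Sigma := fun u => P (u - v).

Definition contains (Sigma : finType) (Q P : pattern Sigma) : Prop :=
  forall u : cell, pdom P u -> Q u = P u.

Definition zero_gluing (Sigma : finType) (o : Sigma) (I : Type)
    (P : I -> pattern Sigma) (R : pattern Sigma) : Prop :=
  [/\ pdom R = \bigcup_(i in [set: I]) pdom (P i),
      forall i : I, contains R (P i)
    & forall i j : I, i <> j -> forall u : cell,
        pdom (P i) u -> pdom (P j) u -> P i u = Some o /\ P j u = Some o].

Definition zero_padding (Sigma : finType) (o : Sigma) (r : nat)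
    (R : pattern Sigma) : pattern Sigma :=
  fun u => if R u is Some a then Some a
           else if `[< nbhd r (psupp o R) u >] then Some o else None.

Definition fill (Sigma : finType) (o : Sigma) (P : pattern Sigma) :
    config Sigma := fun u => odflt o (P u).

Definition cluster_fractal (Sigma : finType) (o : Sigma) (x : config Sigma) :
    Prop :=
  x <> zero_config o /\
  exists (r : nat -> nat) (B : nat -> set (pattern Sigma)),
    [/\ forall i : nat, (r i < r i.+1)%N,
        forall i : nat, finite_set (B i) /\
          forall P, B i P -> finite_set (pdom P) /\ rcluster o (r i) P,
        forall i : nat, forall Q, B i.+1 Q ->
          [/\ exists (n : nat) (P : 'I_n -> pattern Sigma)
                     (v : 'I_n -> cell) (R : pattern Sigma),
                [/\ forall k, B i (P k),
                    zero_gluing o (fun k => translate (v k) (P k)) R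
                  & Q = zero_padding o (r i.+1) R],
              forall P, B i P -> exists v : cell, contains Q (translate v P)
            & exists (P P' : pattern Sigma) (v v' : cell),
                [/\ B i P /\ B i P',
                    contains Q (translate v P),
                    contains Q (translate v' P')
                  & psupp o (translate v P) `&` psupp o (translate v' P')
                    = set0]]
      & exists (v : nat -> cell) (b : nat -> pattern Sigma),
          (forall j : nat, B j (b j)) /\
          (fun j : nat => shiftc (v j) (fill o (b j))) @ \oo --> x].

(* Main.v *)
Require Import Defs.
From mathcomp Require Import all_boot all_order all_algebra.
From mathcomp Require Import all_classical all_reals all_analysis.
From mathcomp Require Import zify.

(** Every nonzero point of [X] has orbit closure [X] ([orbit_closureE]), so it
    is enough to find one nonzero point of [X] of one of the three kinds, and
    there is nothing to do if [X] has a nonzero finite point. Call nonzero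
    cells at distance at most [r] adjacent; a chain is a path in this graph on
    the support of a configuration.

    Sparseness of the trace is only a pointwise hypothesis, and its uniform
    consequence comes from Baire category: the horizontal strips of fixed
    height through a configuration have finite support, so some finite pattern
    forces a bound on the support in the strip through its centre
    ([bottleneck_pattern]). In an almost minimal subshift every pattern occurs
    within a uniform distance of every nonzero cell ([syndetic]), hence every
    nonzero cell has nearby a bottleneck: a nonzero cell such that the whole
    strip around its row is supported near it ([bottlenecks]).

    Suppose that for some [r] there are arbitrarily long chains. Bottlenecks
    bound the diameter of a chain in terms of its vertical extent
    ([strip_chain]), so there are chains crossing arbitrarily many rows. A
    chain that passes the rows of two bottlenecks has to pass near both of
    them, which bounds the horizontal offset of any two nonzero cells by a
    function of their vertical offset ([chain_width]). A limit centred on the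
    chains is therefore a configuration crossed by chains of all heights
    ([spine_exists]): it is nonempty in every strip, and it is of bounded
    width in every strip. Enumerating its support row by row is an ascending
    path with bounded steps, and this path inherits uniform recurrence from
    [syndetic], because the successor of a cell is determined by a bounded
    window around it ([spine_highway]).

    Suppose on the contrary that for every [r] the chains have bounded
    diameter, and that the support of every nonzero point is infinite. Then
    for each [r] there are finitely many [r]-clusters up to translation, and
    for [r'] large enough with respect to [r], recurrence puts a copy of each
    of them, and at least two disjoint ones, into every [r']-cluster
    ([growth]). The clusters for a sufficiently fast sequence of radii are the
    levels of a cluster fractal, and every nonzero point is a limit of them
    ([bounded_cluster_fractal]). *)

Set Implicit Arguments.
Unset Strict Implicit.
Unset Printing Implicit Defensive.

Import Order.TTheory GRing.Theory Num.Theory.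

Local Open Scope classical_set_scope.
Local Open Scope ring_scope.

(** * Cells, agreement on balls, and compactness *)

Lemma fst_add (u v : cell) : (u + v).1 = u.1 + v.1. Proof. by []. Qed.
Lemma snd_add (u v : cell) : (u + v).2 = u.2 + v.2. Proof. by []. Qed.
Lemma fst_opp (u : cell) : (- u).1 = - u.1. Proof. by []. Qed.
Lemma snd_opp (u : cell) : (- u).2 = - u.2. Proof. by []. Qed.
Lemma fst_0 : (0 : cell).1 = 0. Proof. by []. Qed.
Lemma snd_0 : (0 : cell).2 = 0. Proof. by []. Qed.

Lemma dist_le (u v : cell) (n : nat) :
  (dist u v <= n)%N <-> `|u.1 - v.1|%R <= n%:Z /\ `|u.2 - v.2|%R <= n%:Z.
Proof. rewrite /dist; split; [move=> H; split|move=> []]; lia. Qed.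

Definition coords := (fst_add, snd_add, fst_opp, snd_opp, fst_0, snd_0).

Ltac dist_hyps :=
  repeat match goal with
  | H : is_true (dist _ _ <= _)%N |- _ =>
      move/dist_le: H; rewrite ?coords /=; move=> [? ?]
  end.
Ltac cells :=
  dist_hyps;
  try (match goal with |- is_true (dist _ _ <= _)%N => apply/dist_le end);
  rewrite ?coords /=; try split; lia.

Notation mag u := (dist u 0%R).

Section Agreement.
Variable Sigma : finType.
Implicit Types (x y z : config Sigma) (X : set (config Sigma)).

Definition agree (m : nat) y z := forall u, (mag u <= m)%N -> y u = z u.

Definition box (m : nat) : seq cell :=
  [seq (i%:Z - m%:Z, j%:Z - m%:Z) | i <- iota 0 (2 * m + 1), j <- iota 0 (2 * m + 1)].

Lemma mem_box m u : (u \in box m) = (mag u <= m)%N.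
Proof.
apply/allpairsP/idP => [[[i j] [+ + ->]]|].
  rewrite !mem_iota /= => h1 h2; cells.
case: u => a b /dist_le; rewrite ?coords /= => -[h1 h2].
exists (absz (a + m%:Z), absz (b + m%:Z)).
by rewrite !mem_iota; split=> /=; [lia|lia|congr pair; lia].
Qed.

Lemma nbhs_agree m y : nbhs y [set z | agree m y z].
Proof.
have FF : Filter (nbhs y) by exact: nbhs_filter.
have H (s : seq cell) : nbhs y [set z | forall u, u \in s -> y u = z u].
  elim: s => [|u s IH]; first by apply: filterS filterT => z _ u.
  have Hu : nbhs y [set z : config Sigma | y u = z u].
    apply: (@proj_continuous cell (fun _ => discrete_topology Sigma) u y).
    rewrite nbhs_principalE; exact/principal_filterP.
  apply: filterS (filterI Hu IH) => z [/= h1 h2] v.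
  by rewrite inE => /orP[/eqP->|/h2].
by apply: filterS (H (box m)) => z + u hu; apply; rewrite mem_box.
Qed.

Lemma agree_sym m y z : agree m y z -> agree m z y.
Proof. by move=> h u /h. Qed.

Lemma agree_trans m x y z : agree m x y -> agree m y z -> agree m x z.
Proof. by move=> h1 h2 u hu; rewrite h1 ?h2. Qed.

Lemma agree_le m n y z : (m <= n)%N -> agree n y z -> agree m y z.
Proof. by move=> hmn h u hu; apply/h/leq_trans/hmn. Qed.

Lemma cvg_agree (z : nat -> config Sigma) x :
  (forall m, exists N, forall n, (N <= n)%N -> agree m (z n) x) -> z @ \oo --> x.
Proof.
move=> H; apply/cvg_sup => u.
have surj : (fun f : cell -> discrete_topology Sigma => f u) @` setT = setT.
  by rewrite eqEsubset; split=> v // _; exists (cst v).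
apply/cvg_image=> // A; rewrite nbhs_principalE => /principal_filterP hA.
exists ((fun f : cell -> discrete_topology Sigma => f u) @^-1` A); last first.
  exact: image_preimage.
have [N hN] := H (mag u); exists N => // n /= /hN.
by rewrite /agree => /(_ u (leqnn _)) ->.
Qed.

Lemma closureP (A : set (config Sigma)) y :
  closure A y <-> forall m, exists2 z, A z & agree m y z.
Proof.
split=> [h m|h].
  have [z [Az hz]] := h _ (nbhs_agree m y); by exists z.
have /choice[z hz] : forall m, exists z, A z /\ agree m y z.
  by move=> m; have [z Az hz] := h m; exists z.
apply: (@closed_cvg _ _ \oo _ z (closure A)).
- apply: closed_closure.
- by apply: nearW => n; apply: subset_closure; case: (hz n).
- apply: cvg_agree => m; exists m => n hn; apply: agree_sym.
  by apply: agree_le hn _; case: (hz n).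
Qed.

Lemma closed_agree X y : closed X ->
  (forall m, exists2 z, X z & agree m y z) -> X y.
Proof. by move=> cX h; apply: cX; apply/closureP. Qed.

(** Sequential compactness in the form used below: a limit [y] of [z] along a
    subsequence, which reads local properties off the [z n]. *)
Lemma cluster_agree X (z : nat -> config Sigma) : closed X ->
  (forall n, X (z n)) ->
  exists2 y, X y & forall m N, exists2 n, (N <= n)%N & agree m y (z n).
Proof.
move=> cX Xz.
have cT : compact [set: config Sigma].
  have -> : [set: config Sigma] = [set f | forall i, setT (f i)].
    by apply/seteqP; split.
  apply: (@tychonoff cell (fun _ => discrete_topology Sigma) (fun=> setT)) => _.
  apply: finite_compact; exact: (@finite_finset Sigma setT).
have zX : (z @ \oo) ([set: config Sigma] `&` X).
  by exists 0%N => // n _; split=> //; exact: Xz.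
have [y [Xy cy]] := compact_closedI cT cX (fmap_proper_filter z _) zX.
exists y; first by case: Xy.
move=> m N.
have tail : (z @ \oo) [set z n | n in [set n | (N <= n)%N]].
  by exists N => // n /= Nn; exists n.
have [_ [[n /= Nn <-] hn]] := cy _ _ tail (nbhs_agree m y).
by exists n.
Qed.
End Agreement.

(** * Recurrence in almost minimal subshifts *)

Section AlmostMinimal.
Variables (Sigma : finType) (o : Sigma) (X : set (config Sigma)).
Implicit Types (x y z : config Sigma).
Hypothesis X_min : almost_minimal o X.

Let closedX : closed X. Proof. by case: X_min => -[]. Qed.

Lemma shiftX v x : X x -> X (shiftc v x).
Proof. by case: X_min => -[_ _ h] _ _; exact: h. Qed.

Lemma nonzeroX : exists2 x, X x & x 0 <> o.
Proof.
have [[[x0 Xx0] _ _] X0 _] := X_min.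
have [[x Xx [u xu]]|h] := pselect (exists2 x, X x & exists u, x u <> o).
  exists (shiftc u x); first exact: shiftX.
  by rewrite /shiftc add0r.
have z x : X x -> x = zero_config o.
  move=> Xx; apply/funext => u; apply: contrapT => xu; apply: h.
  by exists x => //; exists u.
case: X0; apply/seteqP; split=> [_ ->|x /z -> //].
by rewrite -(z _ Xx0).
Qed.

(** The orbit closure of a nonzero point is a subsystem other than the empty
    one and the one-point one. *)
Lemma orbit_closureE x u : X x -> x u <> o -> orbit_closure x = X.
Proof.
move=> Xx xu; have [_ _ /(_ (orbit_closure x)) [+ _]] := X_min.
have xin : orbit_closure x x.
  by apply: subset_closure; exists 0 => //; apply/funext => w; rewrite /shiftc addr0.
case.
- split.
  + move=> y /closureP h; apply: closed_agree => // m.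
    have [_ [v _ <-] hy] := h m; exists (shiftc v x) => //; exact: shiftX.
  + by apply: closed_closure.
  + move=> v y /closureP h; apply/closureP => m.
    have [_ [w _ <-] hy] := h (m + mag v)%N.
    exists (shiftc (v + w) x); first by exists (v + w).
    move=> t ht; rewrite /shiftc addrA; apply: hy.
    have := leqnn (mag v) => hv; cells.
- by move=> h; rewrite h in xin.
- by [].
- move=> h; rewrite h in xin; by rewrite xin in xu.
Qed.

Lemma orbit_dense x u y m : X x -> x u <> o -> X y ->
  exists v, agree m y (shiftc v x).
Proof.
move=> Xx xu Xy; have := orbit_closureE Xx xu.
move=> /(congr1 (fun A => A y)) e; have : orbit_closure x y by rewrite e.
by move=> /closureP /(_ m) [_ [v _ <-] h]; exists v.
Qed.

(** Compactness makes the density of each nonzero orbit uniform, both in the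
    configuration [z] that is searched and in the configuration [y] whose
    central ball is looked for. *)
Lemma syndetic m : exists R : nat, forall y z u, X y -> X z -> z u <> o ->
  exists2 v, (dist v u <= R)%N & forall w, (mag w <= m)%N -> z (w + v) = y w.
Proof.
pose Q y R := forall z, X z -> z 0 <> o ->
  exists2 v, (mag v <= R)%N & agree m y (shiftc v z).
(* By shift invariance it is enough to search around the origin. *)
suff [R HR] : exists R, forall y, X y -> Q y R.
  exists R => y z u Xy Xz zu.
  have [||v hv h] := HR y Xy (shiftc u z); first exact: shiftX.
    by rewrite /shiftc add0r.
  exists (v + u); first by cells.
  by move=> w hw; rewrite (h w hw) /shiftc addrA.
(* For a fixed [y], a limit of counterexamples [z] would have a nonzero orbit
   avoiding the ball of [y]. *)
have Qy y : X y -> exists R, Q y R.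
  move=> Xy; apply: contrapT => /forallNP H.
  have /choice[z hz] : forall R, exists z, [/\ X z, z 0 <> o &
      forall v, (mag v <= R)%N -> ~ agree m y (shiftc v z)].
    move=> R; apply: contrapT => h; apply: (H R) => z Xz z0.
    apply: contrapT => h2; apply: h; exists z; split=> // v hv ha.
    by apply: h2; exists v.
  have [|z' Xz' hz'] := cluster_agree closedX (z := z).
    by move=> n; case: (hz n).
  have z'0 : z' 0 <> o.
    have [n _ /(_ 0) ->] := hz' 0%N 0%N; last by [].
    by case: (hz n).
  have [v hv] := orbit_dense m Xz' z'0 Xy.
  have [n hn ha] := hz' (m + mag v)%N (mag v).
  have [_ _ /(_ v hn)] := hz n; apply.
  move=> w hw; rewrite (hv w hw); apply: ha.
  have := leqnn (mag v) => hv'; cells.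
(* A radius for [y'] also serves every [y] agreeing with [y'] on the ball. *)
apply: contrapT => /forallNP H.
have /choice[y hy] : forall R, exists y, X y /\ ~ Q y R.
  move=> R; apply: contrapT => h; apply: (H R) => y Xy.
  by apply: contrapT => h2; apply: h; exists y.
have [|y' Xy' hy'] := cluster_agree closedX (z := y).
  by move=> n; case: (hy n).
have [R QR] := Qy _ Xy'.
have [n hn ha] := hy' m R.
case: (hy n) => _; apply => z Xz z0; have [v hv h] := QR z Xz z0.
exists v; first by apply: leq_trans hn.
exact: agree_trans (agree_sym ha) h.
Qed.

End AlmostMinimal.

(** * Chains of cells *)

Definition chain (r : nat) (S : set cell) (u : cell) (s : seq cell) : Prop :=
  path (fun a b => dist a b <= r)%N u s /\ forall w : cell, w \in u :: s -> S w.

Lemma distC u v : dist u v = dist v u.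
Proof. by rewrite /dist; lia. Qed.

Lemma last_split (T : Type) (p : pred T) x s : p x ->
  exists s1 s2, [/\ s = s1 ++ s2, p (last x s1) & ~~ has p s2].
Proof.
move=> px; elim/last_ind: s => [|s z [s1 [s2 [-> p1 p2]]]].
  by exists [::], [::].
have [pz|pz] := boolP (p z).
  by exists (rcons (s1 ++ s2) z), [::]; rewrite cats0 last_rcons.
exists s1, (rcons s2 z); split=> //; first by rewrite rcons_cat.
by rewrite has_rcons negb_or pz.
Qed.

Lemma first_split (T : Type) (p : pred T) x s : p (last x s) ->
  exists s1 s2, [/\ s = s1 ++ s2, p (last x s1) & ~~ has p (belast x s1)].
Proof.
elim: s x => [|a s IH] x /= h; first by exists [::], [::].
have [px|px] := boolP (p x); first by exists [::], (a :: s).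
have [s1 [s2 [-> p1 p2]]] := IH _ h.
by exists (a :: s1), s2; rewrite /= negb_or px.
Qed.

Lemma chain_cat r S u s1 s2 :
  chain r S u (s1 ++ s2) -> chain r S u s1 /\ chain r S (last u s1) s2.
Proof.
rewrite /chain cat_path => -[/andP[h1 h2] h]; split; split=> // w hw; apply: h.
  by move: hw; rewrite !inE mem_cat orbA => ->.
move: hw; rewrite inE => /orP[/eqP->|hw].
  by move: (mem_last u s1); rewrite !inE mem_cat orbA => ->.
by rewrite inE mem_cat hw !orbT.
Qed.

Lemma chain_sub r (S S' : set cell) u s : chain r S u s ->
  (forall w : cell, w \in u :: s -> S' w) -> chain r S' u s.
Proof. by case. Qed.

Lemma chain_prefix r S u s w : chain r S u s -> w \in u :: s ->
  exists2 s1, chain r S u s1 & last u s1 = w.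
Proof.
move=> + hw; case/splitPl: hw => s1 s2 <- /chain_cat[h _].
by exists s1.
Qed.

Lemma chain_rev r S u s : chain r S u s ->
  exists2 s', chain r S (last u s) s' & last (last u s) s' = u.
Proof.
move=> [h1 h2]; exists (rev (belast u s)); last first.
  by case: s {h1 h2} => //= a s; rewrite rev_cons last_rcons.
split.
  rewrite rev_path; apply: sub_path h1 => a b; by rewrite distC.
move=> w hw; apply: h2; move: hw.
by rewrite inE mem_rev lastI mem_rcons inE.
Qed.

Lemma chain_shift r S u s v : chain r S u s ->
  chain r [set w | S (w + v)] (u - v) (map (fun w => w - v) s).
Proof.
move=> [h1 h2]; split.
  rewrite -[u - v]/((fun w : cell => w - v) u) path_map.
  by apply: sub_path h1 => a b /= h; cells.
move=> w; rewrite -(map_cons (fun w => w - v)) => /mapP[w' /h2 h ->] /=.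
by rewrite subrK.
Qed.

(** A chain can be followed by jumps: from [u] go to the last cell having the
    colour of [u], which is at distance at most [D], then one step further.  The
    rest of the chain avoids that colour, so at most [n] jumps are made. *)
Lemma color_chain (C : eqType) (c : cell -> C) (D r n : nat) (L : seq C) u s :
  (size L <= n)%N -> path (fun a b => dist a b <= r)%N u s ->
  (forall w : cell, w \in u :: s -> c w \in L) ->
  (forall w w' : cell, w \in u :: s -> w' \in u :: s -> c w = c w' ->
     (dist w w' <= D)%N) ->
  (dist u (last u s) <= n * (D + r))%N.
Proof.
elim: n L u s => [|n IH] L u s.
  rewrite leqn0 size_eq0 => /eqP-> _ h.
  by have := h u; rewrite inE eqxx => /(_ isT).
move=> sL + hL hD.
have [s1 [s2 [e /eqP p1 p2]]] := @last_split _ (fun w => c w == c u) u s (eqxx _).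
rewrite {}e in hL hD *; rewrite cat_path last_cat => /andP[h1 h2].
set a := last u s1 in p1 h2 *.
have ua : (dist u a <= D)%N.
  apply: hD => //; first by rewrite inE eqxx.
  by move: (mem_last u s1); rewrite !inE mem_cat orbA => ->.
case: s2 p2 hL hD h2 => [|b s2] p2 hL hD /=.
  by move=> _; apply: leq_trans ua _; rewrite mulSn -addnA leq_addr.
move=> /andP[ab h2].
have : (dist b (last b s2) <= n * (D + r))%N.
  have sub w : w \in b :: s2 -> w \in u :: s1 ++ b :: s2.
    by move=> hw; rewrite inE mem_cat hw !orbT.
  apply: (IH [seq x <- L | x != c u]) => //.
  - rewrite size_filter -ltnS; apply: leq_trans sL.
    rewrite -(count_predC (pred1 (c u)) L) -add1n leq_add //.
    by rewrite -has_count has_pred1; apply: hL; rewrite inE eqxx.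
  - move=> w hw; rewrite mem_filter hL ?andbT; last exact: sub.
    by move/hasPn: p2 => /(_ w hw).
  - by move=> w w' /sub hw /sub hw'; exact: hD.
by move: ua ab; rewrite mulSn; move: (n * _)%N => q ? ? ?; cells.
Qed.

(** * Bottlenecks and spines *)

(** A chain of step [r] cannot jump over the [2 * r + 1] rows around [u'], so a
    chain in [S] from below these rows to above them passes near [u']. *)
Definition bottlenecked (r R : nat) (S : set cell) : Prop :=
  forall u, S u -> exists u', [/\ S u', (dist u u' <= R)%N &
    forall w, S w -> `|w.2 - u'.2| <= r%:Z -> `|w.1 - u'.1| <= R%:Z].

(** Colour a cell by the row of its bottleneck.  Two bottlenecks in the same row
    are close, hence so are two cells of the same colour, and the rows
    available as colours are those at distance at most [R] from the strip. *)
Lemma strip_chain r R S (a : int) (K : nat) u s : bottlenecked r R S ->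
  chain r S u s -> (forall w : cell, w \in u :: s -> a <= w.2 <= a + K%:Z) ->
  (dist u (last u s) <= (K + 2 * R + 1) * (3 * R + r))%N.
Proof.
move=> bn [h1 h2] h3.
have /choice[f hf] : forall u, exists u', S u -> [/\ S u', (dist u u' <= R)%N &
    forall w, S w -> `|w.2 - u'.2| <= r%:Z -> `|w.1 - u'.1| <= R%:Z].
  move=> w; have [/bn[w' hw']|h] := pselect (S w); first by exists w'.
  by exists 0.
apply: (@color_chain _ (fun w => (f w).2) _ _ _
  [seq (a - R%:Z + i%:Z) | i <- iota 0 (K + 2 * R + 1)]) => //.
- by rewrite size_map size_iota.
- move=> w hw; have [_ hd _] := hf w (h2 w hw); have := h3 w hw => hr.
  apply/mapP; exists (absz ((f w).2 - a + R%:Z)).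
    by rewrite mem_iota; dist_hyps; lia.
  by dist_hyps; lia.
- move=> w w' hw hw' e.
  have [_ d1 e1] := hf w (h2 w hw); have [s2 d2 e2] := hf w' (h2 w' hw').
  have := e1 _ s2; rewrite e subrr normr0 => /(_ isT) h.
  cells.
Qed.

(** Cut the chain at its first visit above [B], and then at its last visit
    below [A] before that: in between it stays strictly between these rows, and
    one step exceeds either row by at most [r]. *)
Lemma crossing r S u s (A B : int) : chain r S u s ->
  u.2 <= A -> A <= B -> B <= (last u s).2 ->
  exists u' s', [/\ chain r S u' s', `|u'.2 - A| <= r%:Z,
    `|(last u' s').2 - B| <= r%:Z &
    forall w : cell, w \in u' :: s' -> A - r%:Z <= w.2 <= B + r%:Z].
Proof.
move=> ch uA AB lB.
have [s1 [s2 [e p1 p2]]] := @first_split _ (fun w : cell => B <= w.2) u s lB.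
rewrite e in ch; have [ch1 _] := chain_cat ch.
have H1 : `|(last u s1).2 - B| <= r%:Z /\
    forall w : cell, w \in u :: s1 -> w.2 <= B + r%:Z.
  have H0 : `|(last u s1).2 - B| <= r%:Z.
    move: p1 p2 ch1; case/lastP: s1 {e ch} => [|s1 b] /=; first by lia.
    rewrite last_rcons belast_rcons => hb p2 [+ _].
    rewrite rcons_path => /andP[_] hd.
    have : last u s1 \in u :: s1 by exact: mem_last.
    by move/hasPn: p2 => h /h; dist_hyps; lia.
  split=> // w; rewrite lastI mem_rcons inE => /orP[/eqP->|]; first lia.
  by move/hasPn: p2 => h /h; lia.
have [s3 [s4 [e3 p3 p4]]] := @last_split _ (fun w : cell => w.2 <= A) u s1 uA.
rewrite e3 in ch1 H1 p1; have [_ ch2] := chain_cat ch1.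
rewrite last_cat in H1 p1.
set u' := last u s3 in ch2 p1 p3 H1.
have sub w : w \in u' :: s4 -> w \in u :: s3 ++ s4.
  rewrite inE => /orP[/eqP->|hw].
    by move: (mem_last u s3); rewrite !inE mem_cat orbA => ->.
  by rewrite inE mem_cat hw !orbT.
have H2 : `|u'.2 - A| <= r%:Z.
  case: s4 {e3 ch1 H1 sub} p1 p4 ch2 => [|b s4] /=; first by lia.
  rewrite negb_or => _ /andP[hb _] [/= /andP[hd _] _].
  dist_hyps; lia.
exists u', s4; split=> //; first by case: H1.
move=> w hw; have [_ /(_ w (sub w hw)) ->] := H1.
rewrite andbT; move: hw; rewrite inE => /orP[/eqP->|hw]; first lia.
by move/hasPn: p4 => /(_ w hw); lia.
Qed.

Definition width_bound r R k := (4 * R + (k + 4 * R + 2 * r + 1) * (3 * R + r))%N.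

(** The crossing chain meets the rows of the bottlenecks of [u] and of [v],
    hence passes near both; the part of the chain in between is controlled by
    [strip_chain]. *)
Lemma chain_width r R S k a s u v : bottlenecked r R S -> chain r S a s ->
  S u -> S v -> `|u.2 - v.2| <= k%:Z ->
  a.2 + R%:Z <= u.2 <= (last a s).2 - R%:Z ->
  a.2 + R%:Z <= v.2 <= (last a s).2 - R%:Z ->
  `|u.1 - v.1| <= (width_bound r R k)%:Z.
Proof.
move=> bn ch Su Sv uv hu hv.
have [u' [Su' du hu']] := bn u Su; have [v' [Sv' dv hv']] := bn v Sv.
wlog le : u v Su Sv uv hu hv u' v' Su' du hu' Sv' dv hv' / u'.2 <= v'.2.
  move=> H; have [le|/ltW le] := leP u'.2 v'.2; first by apply: (H u v _ _ _ _ _ u' v').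
  by rewrite distrC; apply: (H v u _ _ _ _ _ v' u') => //; rewrite distrC.
have [| |q [t [cht hq hl hin]]] := crossing ch _ le.
- by dist_hyps; lia.
- by dist_hyps; lia.
have Sq : S q by case: cht => _; apply; rewrite inE eqxx.
have Sl : S (last q t) by case: cht => _; apply; exact: mem_last.
have {}hq := hu' _ Sq hq; have {}hl := hv' _ Sl hl.
have hD := @strip_chain r R S (u'.2 - r%:Z) (k + 2 * R + 2 * r) q t bn cht _.
have {hD}: (dist q (last q t) <= (k + 2 * R + 2 * r + 2 * R + 1) * (3 * R + r))%N.
  by apply: hD => w /hin; dist_hyps; lia.
rewrite /width_bound.
have -> : (k + 4 * R + 2 * r + 1 = k + 2 * R + 2 * r + 2 * R + 1)%N by lia.
move: (_ * (3 * R + r))%N => n1 hd; dist_hyps; lia.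
Qed.

Definition narrow (S : set cell) : Prop := forall k : nat, exists W : nat,
  forall u v, S u -> S v -> `|u.2 - v.2| <= k%:Z -> `|u.1 - v.1| <= W%:Z.

Definition row_syndetic (r : nat) (S : set cell) : Prop :=
  forall b : int, exists2 w, S w & `|w.2 - b| <= r%:Z.

Section Bottlenecks.
Variables (Sigma : finType) (o : Sigma) (X : set (config Sigma)).
Implicit Types (x y z : config Sigma).
Hypothesis X_min : almost_minimal o X.
Hypothesis sparseX : sparse o (trace X).

Let closedX : closed X. Proof. by case: X_min => -[]. Qed.

Lemma finite_int_bounded (A : set int) : finite_set A ->
  exists n : nat, forall a, A a -> `|a| <= n%:Z.
Proof.
move=> /finite_seqP[s ->]; elim: s => [|b s [n hn]]; first by exists 0%N.
exists (n + absz b)%N => a /=; rewrite inE => /orP[/eqP->|/hn]; lia.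
Qed.

Lemma strip_bounded r y : X y -> exists n : nat, forall w, csupp o y w ->
  `|w.2| <= r%:Z -> `|w.1| <= n%:Z.
Proof.
move=> Xy.
have row (b : int) : exists n : nat, forall w, csupp o y w -> w.2 = b ->
    `|w.1| <= n%:Z.
  have [|n hn] := @finite_int_bounded [set j | y (j, b) <> o].
    by apply: (sparseX (y := fun j => y (j, b))); exists y; split=> //; exists b.
  by exists n => -[a c] /= hw e; apply: hn; rewrite /= -e.
elim: r => [|r [n hn]].
  have [n hn] := row 0; exists n => w hw h; apply: hn => //; lia.
have [n1 h1] := row r.+1%:Z; have [n2 h2] := row (- r.+1%:Z).
exists (n + n1 + n2)%N => w hw hr.
have [e|ne1] := eqVneq w.2 (r.+1%:Z); first by have := h1 w hw e; lia.
have [e|ne2] := eqVneq w.2 (- r.+1%:Z); first by have := h2 w hw e; lia.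
have := hn w hw; lia.
Qed.

(** Baire category by hand.  If every pattern could be extended so as to
    have a nonzero cell far away in the strip, iterating such extensions would
    converge to a configuration of [X] with infinitely many nonzero cells in
    the strip. *)
Lemma bottleneck_pattern r : exists (y : config Sigma) (m n : nat),
  [/\ X y, y 0 <> o & forall z, X z -> agree m y z -> forall w, csupp o z w ->
    `|w.2| <= r%:Z -> `|w.1| <= n%:Z].
Proof.
apply: contrapT => H.
(* A pair stands for a configuration and the radius of the ball on which it is
   already settled. *)
have step (p : config Sigma * nat) : exists q : config Sigma * nat,
    X p.1 /\ p.1 0 <> o -> [/\ X q.1, q.1 0 <> o, agree p.2 p.1 q.1, (p.2 < q.2)%N &
      exists w, [/\ csupp o q.1 w, `|w.2| <= r%:Z, p.2%:Z < `|w.1| & (mag w <= q.2)%N]].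
  have [[Xp p0]|] := pselect (X p.1 /\ p.1 0 <> o); last by exists p.
  apply: contrapT => h; apply: H; exists p.1, p.2, p.2; split=> // z Xz az w zw wr.
  rewrite leNgt; apply/negP => lt; apply: h.
  exists (z, (p.2 + mag w).+1) => _ /=; split=> //.
  - by rewrite -(az 0).
  - by rewrite ltnS leq_addr.
  - by exists w; split=> //; lia.
have /choice[f hf] := step.
have [x0 Xx0 x00] := nonzeroX X_min.
pose Y k := iter k f (x0, 0%N).
have good k : X (Y k).1 /\ (Y k).1 0 <> o.
  by elim: k => [|k /hf[]].
have mk k : (k <= (Y k).2)%N.
  elim: k => // k IH; have [_ _ _ h _] := hf _ (good k); exact: leq_ltn_trans IH h.
have ag k d : agree (Y k).2 (Y k).1 (Y (k + d)%N).1 /\ ((Y k).2 <= (Y (k + d)%N).2)%N.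
  elim: d => [|d [IH1 IH2]]; first by rewrite addn0.
  rewrite addnS; have [_ _ h1 h2 _] := hf _ (good (k + d)%N); split.
    exact: agree_trans IH1 (agree_le IH2 h1).
  exact: leq_trans IH2 (ltnW h2).
pose y : config Sigma := fun u => (Y (mag u)).1 u.
have ay k : agree (Y k).2 y (Y k).1.
  move=> u hu; rewrite /y; have [le|/ltnW le] := leqP (mag u) k.
    rewrite -(subnKC le); have [-> //] := ag (mag u) (k - mag u)%N; exact: mk.
  rewrite -(subnKC le); by have [->] := ag k (mag u - k)%N.
have Xy : X y.
  apply: closed_agree => // m; exists (Y m).1; first by case: (good m).
  exact: agree_le (mk m) (ay m).
have [n hn] := strip_bounded r Xy.
have [_ _ _ _ [w [w1 w2 w3 w4]]] := hf _ (good n).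
have := hn w; rewrite /csupp /= (ay n.+1 w w4) => /(_ w1 w2).
have := mk n; lia.
Qed.

Lemma bottlenecks r : exists R, forall z, X z -> bottlenecked r R (csupp o z).
Proof.
have [y [m [n [Xy y0 hy]]]] := bottleneck_pattern r.
have [R hR] := syndetic X_min m.
exists (R + n)%N => z Xz u zu.
have [v dv hv] := hR y z u Xy Xz zu.
exists v; split.
- by have := hv 0; rewrite add0r /csupp /= => ->.
- by rewrite distC; apply: leq_trans dv (leq_addr _ _).
- move=> w zw hw.
  have := hy (shiftc v z) (shiftX X_min v Xz) _ (w - v).
  rewrite /csupp /= {2}/shiftc subrK => h.
  have : `|(w - v).1| <= n%:Z.
    by apply: h => //= t ht; rewrite /shiftc hv.
  rewrite /=; lia.
Qed.

(** The definition leaves open which chain is taken for each [n], so that it is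
    preserved by limits. *)
Definition through r S n := exists u s,
  [/\ chain r S u s, u.2 <= - n%:Z & n%:Z <= (last u s).2].

Section LongChains.
Variables (r R : nat).
Hypothesis bn : forall z, X z -> bottlenecked r R (csupp o z).
Hypothesis long_chains : forall n : nat, exists y u s,
  [/\ X y, chain r (csupp o y) u s & (n < dist u (last u s))%N].

(** A chain too long for a strip of height [2 * h] leaves it; it is reversed
    if it leaves downwards. *)
Lemma tall (h : nat) : exists y u s,
  [/\ X y, chain r (csupp o y) u s & u.2 + h%:Z <= (last u s).2].
Proof.
have [y [u [s [Xy ch hd]]]] := long_chains ((2 * h + 2 * R + 1) * (3 * R + r)).
have [[w wus hw]|H] := pselect (exists2 w : cell, w \in u :: s & h%:Z <= `|w.2 - u.2|).
  have [s1 ch1 e] := chain_prefix ch wus.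
  have [le|/ltW le] := leP u.2 w.2.
    exists y, u, s1; split=> //; rewrite e; lia.
  have [s2 ch2 e2] := chain_rev ch1.
  exists y, (last u s1), s2; split=> //; rewrite e2 e; lia.
move: hd; rewrite ltnNge => /negP[].
apply: (@strip_chain r R (csupp o y) (u.2 - h%:Z) (2 * h) u s) => //; first exact: bn.
move=> w wus; have : ~ (h%:Z <= `|w.2 - u.2|) by move=> hw; apply: H; exists w.
lia.
Qed.

Lemma tall_centered n : exists z, [/\ X z, z 0 <> o & through r (csupp o z) n].
Proof.
have [y [u [s [Xy ch hd]]]] := tall (2 * (n + r)).
have [||| w [t [cht hw _ _]]] := crossing (A := u.2 + (n + r)%:Z) (B := u.2 + (n + r)%:Z) ch.
- lia.
- by [].
- lia.
have Sw : csupp o y w by case: cht => _; apply; rewrite inE eqxx.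
exists (shiftc w y); split; first exact: (shiftX X_min).
  by rewrite /shiftc add0r.
exists (u - w), (map (fun a => a - w) s); split.
- exact: (@chain_shift r (csupp o y) u s w ch).
- rewrite !coords; lia.
- rewrite (last_map (fun a : cell => a - w)) -/(last u s - w) !coords; lia.
Qed.

(** A limit of configurations centred at a cell in the middle of taller and
    taller chains.  By [chain_width] the part of these chains in a given strip
    stays within a fixed distance of the centre, so it survives in the
    limit. *)
Lemma spine_exists : exists x, [/\ X x, x 0 <> o & forall n, through r (csupp o x) n].
Proof.
have /choice[z hz] := tall_centered.
have [|x Xx hx] := cluster_agree closedX (z := z); first by move=> n; case: (hz n).
exists x; split=> //.
  by have [n _ /(_ 0)->] := hx 0%N 0%N; first case: (hz n).
move=> k; pose W := width_bound r R (k + 2 * r).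
have [n kn ha] := hx (W + k + 2 * r)%N (k + 2 * r + R)%N.
have [Xz z0 [u [s [ch hu hl]]]] := hz n.
have [||| u' [s' [ch' hu' hl' hin]]] :=
  crossing (A := - (k + r)%:Z) (B := (k + r)%:Z) ch; [lia..|].
exists u', s'; split; [|lia..].
apply: (chain_sub ch') => w hw; rewrite /csupp /= ha.
  by case: ch' => _; apply.
have Sw : csupp o (z n) w by case: ch' => _; apply.
have := chain_width (k := k + 2 * r) (bn Xz) ch Sw z0.
have := hin w hw; rewrite ?coords => h1 h2.
have : `|w.1 - 0| <= W%:Z by apply: h2; lia.
by move=> ?; cells.
Qed.

Lemma spine_width x : X x -> (forall n, through r (csupp o x) n) ->
  narrow (csupp o x).
Proof.
move=> Xx th k; exists (width_bound r R k) => u v xu xv uv.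
have [a [s [ch h1 h2]]] := th (absz u.2 + absz v.2 + R)%N.
by apply: chain_width (bn Xx) ch xu xv uv _ _; lia.
Qed.

Lemma spine_syndetic x : (forall n, through r (csupp o x) n) ->
  row_syndetic r (csupp o x).
Proof.
move=> th b; have [a [s [ch h1 h2]]] := th (absz b).
have [||| w [s' [ch' hw _ _]]] := crossing (A := b) (B := b) ch; [lia..|].
by exists w => //; case: ch' => _; apply; rewrite inE eqxx.
Qed.

End LongChains.
End Bottlenecks.

(** * Enumeration of a narrow set by rows *)

Lemma int_next (K : set int) (a : int) : (exists2 k, K k & a < k) ->
  exists b, [/\ K b, a < b & forall k, K k -> a < k -> b <= k].
Proof.
move=> [k0 Kk0 ak0].
have ex : exists n : nat, `[< K (a + 1 + n%:Z) >].
  exists (absz (k0 - a - 1)%R); apply/asboolP.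
  by have -> : a + 1 + (absz (k0 - a - 1)%R)%:Z = k0 by lia.
exists (a + 1 + (ex_minn ex)%:Z); case: ex_minnP => n /asboolP Kn hn.
split=> //; first lia.
move=> k Kk ak; have := hn (absz (k - a - 1)%R).
have -> : a + 1 + (absz (k - a - 1)%R)%:Z = k by lia.
by move=> /(_ (asboolT Kk)); lia.
Qed.

Lemma int_prev (K : set int) (a : int) : (exists2 k, K k & k < a) ->
  exists b, [/\ K b, b < a & forall k, K k -> k < a -> k <= b].
Proof.
move=> [k0 Kk0 ak0].
have [|b [Kb ab hb]] := @int_next [set k | K (- k)] (- a).
  by exists (- k0); [rewrite /= opprK|lia].
exists (- b); split=> //; first lia.
move=> k Kk ka; have := hb (- k); rewrite /= opprK => /(_ Kk); lia.
Qed.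

(** [q] iterates the successor and the predecessor in [K]; every element
    of [K] is reached because finitely many integers lie between it and [0]. *)
Lemma enum_int (K : set int) : K 0 -> (forall a, exists2 k, K k & a < k) ->
  (forall a, exists2 k, K k & k < a) ->
  exists q : int -> int, [/\ q 0 = 0, forall i, K (q i),
    forall i, q i < q (i + 1),
    forall i k, K k -> q i < k -> q (i + 1) <= k
    & forall k, K k -> exists i, q i = k].
Proof.
move=> K0 up down.
have /choice[nxt nxtP] := fun a => int_next (up a).
have /choice[prv prvP] := fun a => int_prev (down a).
have nxtK a : K a -> prv (nxt a) = a.
  move=> Ka; have [K1 h1 g1] := nxtP a; have [K2 h2 g2] := prvP (nxt a).
  apply/eqP; rewrite eq_le g2 // andbT leNgt; apply/negP => h.
  by have := g1 _ K2 h; lia.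
have prvK a : K a -> nxt (prv a) = a.
  move=> Ka; have [K1 h1 g1] := prvP a; have [K2 h2 g2] := nxtP (prv a).
  apply/eqP; rewrite eq_le g2 //= leNgt; apply/negP => h.
  by have := g1 _ K2 h; lia.
pose q i := match i with Posz n => iter n nxt 0 | Negz n => iter n.+1 prv 0 end.
have Kq i : K (q i).
  case: i => [[|n]|n] //=; first by case: (nxtP (iter n nxt 0)).
  by case: (prvP (iter n prv 0)).
have qS i : q (i + 1) = nxt (q i).
  case: i => [n|n].
    by have -> : Posz n + 1 = Posz n.+1 by lia.
  have -> : Negz n + 1 = - n%:Z by lia.
  have -> : q (- n%:Z) = iter n prv 0.
    by case: n.
  rewrite /= prvK //; case: n => //= n; by case: (prvP (iter n prv 0)).
exists q; split=> //.
- by move=> i; rewrite qS; case: (nxtP (q i)).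
- by move=> i k Kk; rewrite qS; case: (nxtP (q i)) => _ _; apply.
suff H n : forall k : int, (absz k <= n)%N -> K k -> exists i, q i = k.
  by move=> k; apply: (H (absz k)).
elim: n => [|n IH] k hk Kk; first by exists 0; rewrite /=; lia.
have [k0|k0|->] := ltgtP k 0; last by exists 0.
- have [K1 h1 g1] := nxtP k; have [|i qi] := IH (nxt k) _ K1.
    by have := g1 _ K0 k0; lia.
  exists (i - 1); have := qS (i - 1); rewrite subrK qi => /(congr1 prv).
  by rewrite !nxtK.
- have [K1 h1 g1] := prvP k; have [|i qi] := IH (prv k) _ K1.
    by have := g1 _ K0 k0; lia.
  by exists (i + 1); rewrite qS qi prvK.
Qed.

(** Rows come first, so that an increasing enumeration is ascending. *)
Definition lex (u v : cell) : Prop := u.2 < v.2 \/ u.2 = v.2 /\ u.1 < v.1.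

Lemma lex_asym u v : lex u v -> lex v u -> False.
Proof. by rewrite /lex; lia. Qed.

Lemma lexD u v w : lex (u + w) (v + w) <-> lex u v.
Proof. by rewrite /lex !coords; split; lia. Qed.

Section Enum.
Variables (S : set cell) (r : nat).
Hypothesis S0 : S 0.
Hypothesis S_narrow : narrow S.
Hypothesis S_rows : row_syndetic r S.

(** On a narrow set the row-by-row order is isomorphic to a set of integers: if
    all cells of row [b] are within [W] of column [c b], then
    [u.2 * (2 * W + 1) + (u.1 - c u.2)] is strictly monotone. *)
Lemma lex_enum : exists p : int -> cell, [/\ p 0 = 0, forall i, S (p i),
    forall i : int, lex (p i) (p (i + 1)),
    forall (i : int) w, S w -> lex (p i) w -> w = p (i + 1) \/ lex (p (i + 1)) w
    & forall w, S w -> exists i, p i = w].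
Proof.
have [W hW] := S_narrow 0.
have /choice[c hc] : forall b : int, exists c : int, forall u, S u -> u.2 = b ->
    `|u.1 - c| <= W%:Z.
  move=> b; have [[u Su ub]|h] := pselect (exists2 u, S u & u.2 = b).
    by exists u.1 => v Sv vb; apply: hW => //; rewrite ub vb subrr.
  by exists 0 => u Su ub; case: h; exists u.
pose M : int := 2 * W%:Z + 1.
pose key0 (u : cell) : int := u.2 * M + (u.1 - c u.2).
pose key u := key0 u - key0 0.
have keyP u v : S u -> S v -> (key u < key v <-> lex u v).
  have H a b : S a -> S b -> a.2 < b.2 -> key a < key b.
    move=> Sa Sb ab; have := hc _ _ Sa erefl; have := hc _ _ Sb erefl.
    have : (a.2 + 1) * M <= b.2 * M by rewrite ler_wpM2r //; lia.
    rewrite /key /key0 mulrDl mul1r /M; lia.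
  move=> Su Sv; split; last first.
    case=> [h|[e h]]; first exact: H.
    by rewrite /key /key0 e; lia.
  have [h|h|e] := ltgtP u.2 v.2; [by left|by have := H _ _ Sv Su h; lia|].
  by rewrite /key /key0 e => h; right; split=> //; lia.
have keyI u v : S u -> S v -> key u = key v -> u = v.
  move=> Su Sv e; have h1 := keyP u v Su Sv; have h2 := keyP v u Sv Su.
  rewrite e ltxx in h1 h2; have n1 : ~ lex u v by move=> /h1.
  have n2 : ~ lex v u by move=> /h2.
  move: n1 n2; rewrite /lex; case: u v {Su Sv e h1 h2} => [a b] [a' b'] /= n1 n2.
  by congr pair; lia.
pose T : int := `|key0 0| + W%:Z + r%:Z * M.
(* The key set is unbounded in both directions since all rows, up to [r], are
   occupied. *)
have far (b : int) : exists2 w, S w & `|key w - b * M| <= T.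
  have [w Sw hw] := S_rows b; exists w => //.
  have : `|(w.2 - b) * M| <= r%:Z * M by rewrite normrM ler_pM // /M; lia.
  have := hc _ _ Sw erefl; rewrite /T /key /key0 mulrBl; lia.
pose K := key @` S.
have K0 : K 0 by exists 0 => //; rewrite /key subrr.
have M1 : 1 <= M by rewrite /M; lia.
have T0 : 0 <= T by rewrite /T addr_ge0 // mulr_ge0 // /M; lia.
clearbody T.
have big (a : int) : `|a| + T + 1 <= (`|a| + T + 1) * M.
  by rewrite -[X in X <= _]mulr1 ler_wpM2l //; lia.
have up a : exists2 k, K k & a < k.
  have [w Sw hw] := far (`|a| + T + 1); exists (key w); first by exists w.
  by have := big a; lia.
have down a : exists2 k, K k & k < a.
  have [w Sw hw] := far (- (`|a| + T + 1)); exists (key w); first by exists w.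
  by move: hw (big a); rewrite mulNr; lia.
have [q [q0 Kq qlt qnxt qsurj]] := enum_int K0 up down.
have /choice[p hp] : forall i, exists w, S w /\ key w = q i.
  by move=> i; have [w Sw e] := Kq i; exists w.
have Sp i : S (p i) by case: (hp i).
have kp i : key (p i) = q i by case: (hp i).
exists p; split=> //.
- by apply: keyI => //; rewrite kp q0 /key subrr.
- by move=> i; apply/keyP => //; rewrite !kp.
- move=> i w Sw /keyP h; have {}h := h (Sp i) Sw.
  have : q (i + 1) <= key w by apply: qnxt; [exists w|rewrite -kp].
  rewrite le_eqVlt => /orP[/eqP e|hlt]; first by left; apply: keyI; rewrite ?kp.
  by right; apply/keyP => //; rewrite kp.
- move=> w Sw; have [|i qi] := qsurj (key w); first by exists w.
  by exists i; apply: keyI => //; rewrite kp.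
Qed.
End Enum.

(** * The highway carried by a spine *)

(** In this section [p] is the enumeration of [S] given by [lex_enum]. *)
Section Path.
Variables (S : set cell) (r : nat) (p : int -> cell).
Hypothesis S_narrow : narrow S.
Hypothesis S_rows : row_syndetic r S.
Hypothesis Sp : forall i, S (p i).
Hypothesis lexp : forall i : int, lex (p i) (p (i + 1)).
Hypothesis nextp : forall (i : int) w, S w -> lex (p i) w ->
  w = p (i + 1) \/ lex (p (i + 1)) w.

Lemma addz_succ (i : int) (t : nat) : i + t.+1%:Z = i + t%:Z + 1.
Proof. lia. Qed.

Lemma path_step : exists r', forall i : int, (dist (p (i + 1)) (p i) <= r')%N.
Proof.
have [W hW] := S_narrow (2 * r + 1); exists (2 * r + 1 + W)%N => i.
have [w Sw hw] := S_rows ((p i).2 + 1 + r%:Z).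
have hl : lex (p i) w by left; lia.
have h1 := lexp i; rewrite /lex in h1.
have h2 : (p (i + 1)).2 <= w.2.
  have [->//|[h|[h _]]] := nextp Sw hl; lia.
have := hW (p (i + 1)) (p i) (Sp _) (Sp _).
move=> h3; have : `|(p (i + 1)).1 - (p i).1| <= W%:Z by apply: h3; lia.
by move=> ?; cells.
Qed.

Lemma path_mono (i : int) (t : nat) : (p i).2 < (p (i + t%:Z)).2 \/
  (p i).2 = (p (i + t%:Z)).2 /\ (p i).1 + t%:Z <= (p (i + t%:Z)).1.
Proof.
elim: t => [|t IH]; first by right; rewrite !addr0.
by rewrite addz_succ; have := lexp (i + t%:Z); rewrite /lex; lia.
Qed.

(** Each step inside a row moves by at least one column, and a row has width at
    most [m], so [m + 1] successive steps leave the row. *)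
Lemma path_climb : exists m : nat, forall (i : int) (t : nat),
  (p i).2 + t%:Z <= (p (i + (m.+1 * t)%N%:Z)).2.
Proof.
have [m hm] := S_narrow 0; exists m => i; elim=> [|t IH]; first by rewrite muln0 !addr0.
pose j : int := i + (m.+1 * t)%N%:Z; rewrite -/j in IH.
have -> : i + (m.+1 * t.+1)%N%:Z = j + m.+1%:Z by rewrite mulnSr PoszD addrA.
have h := hm (p j) (p (j + m.+1%:Z)) (Sp _) (Sp _).
case: (path_mono j m.+1) => [|[h1 h2]]; first lia.
have := h; rewrite h1 subrr normr0 => /(_ isT); lia.
Qed.

Lemma path_ascending : ascending p.
Proof.
have [m hm] := path_climb; exists m => j; have := hm j 1%N.
by rewrite muln1 -addz_succ subr_gt0 -lezD1.
Qed.

(** By [path_climb] the path leaves the [R] rows around a cell for good after a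
    bounded number of steps. *)
Lemma path_near R : exists C : nat, forall i j : int, (dist (p i) (p j) <= R)%N ->
  `|i - j| <= C%:Z.
Proof.
have [m hm] := path_climb; exists (m.+1 * R.+1)%N.
have H (i j : int) : (dist (p i) (p j) <= R)%N -> i - j <= (m.+1 * R.+1)%N%:Z.
  move=> hd; rewrite leNgt; apply/negP => h.
  have := hm j R.+1; set k : int := j + _ => hk.
  have := path_mono k (absz (i - k)); have -> : k + (absz (i - k)%R)%:Z = i by lia.
  by dist_hyps; lia.
by move=> i j hd; have := H _ _ hd; rewrite distC in hd; have := H _ _ hd; lia.
Qed.

End Path.

Section Highway.
Variables (Sigma : finType) (o : Sigma) (X : set (config Sigma)).
Hypothesis X_min : almost_minimal o X.

(** Recurrence of the coloured path: the ball around [p i] reappears around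
    some [p j] with [j] close to any prescribed index, and the enumerations
    continue in parallel from [p i] and [p j] as long as the next cell
    is inside the ball. *)
Lemma spine_highway (x : config Sigma) r : X x -> x 0 <> o ->
  narrow (csupp o x) -> row_syndetic r (csupp o x) -> highway o x.
Proof.
move=> Xx x0 S_narrow S_rows.
have [p [p0 Sp lexp nextp surjp]] := lex_enum x0 S_narrow S_rows.
have [r' hr'] := path_step S_narrow S_rows Sp lexp nextp.
exists r', p, 0; split=> //.
- exact: path_ascending S_narrow Sp lexp.
- apply/seteqP; split=> [w /surjp[i <-]|_ [i _ <-]]; rewrite ?add0r //.
  by exists i => //; rewrite add0r.
have far (i : int) (t : nat) : (dist (p (i + t%:Z)%R) (p i) <= t * r')%N.
  elim: t => [|t IH]; first by rewrite addr0 /dist !subrr.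
  rewrite addz_succ mulSn; have := hr' (i + t%:Z); move: (t * r')%N IH => q h1 h2.
  by cells.
move=> i n; pose m := (n.+1 * r')%N.
have [R hR] := syndetic X_min m.
have [C hC] := path_near S_narrow Sp lexp R.
exists (2 * C)%N => k.
have [v hv hx] := hR (shiftc (p i) x) x (p (k + C%:Z)) (shiftX X_min _ Xx) Xx (Sp _).
have {}hx w : (mag w <= m)%N -> x (w + v) = x (w + p i) by move=> /hx.
have Sv : csupp o x v.
  by have := hx 0; rewrite !add0r /csupp /= => -> //; exact: Sp.
have [j pj] := surjp v Sv; exists j; split.
  by have := hC j (k + C%:Z); rewrite pj => /(_ hv); lia.
have magp (a : int) (t : nat) : (t <= n)%N -> (mag (p (a + t%:Z) - p a)%R <= m)%N.
  move=> tn; have h : (dist (p (a + t%:Z)%R) (p a) <= m)%N.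
    by apply: leq_trans (far a t) _; rewrite leq_mul2r leqW ?orbT.
  by clearbody m; cells.
have magp' (a : int) (t : nat) : (t < n)%N -> (mag (p (a + t%:Z + 1) - p a)%R <= m)%N.
  by move=> tn; rewrite -addz_succ; exact: magp.
(* The two enumerations are translates of each other; by induction, since
   [p] takes the next cell in an order invariant under translation and the
   candidates for the next cell on either side lie in the ball. *)
have sync t : (t <= n)%N -> p (j + t%:Z) = p (i + t%:Z) - p i + v.
  elim: t => [|t IH] tn; first by rewrite !addr0 pj subrr add0r.
  rewrite (addz_succ i t) (addz_succ j t); have {IH} e := IH (ltnW tn).
  set a := p (i + t%:Z + 1); set b := p (j + t%:Z + 1).
  have Sa : csupp o x (a - p i + v).
    by rewrite /csupp /= hx ?magp' // subrK; exact: Sp.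
  have la : lex (p (j + t%:Z)) (a - p i + v).
    by rewrite e; apply/lexD/lexD; exact: lexp.
  have [//|lba] := nextp _ _ Sa la.
  have Sb : csupp o x (b - v + p i).
    by rewrite /csupp /= -hx ?subrK -?pj ?magp' //; exact: Sp.
  have lb : lex (p (i + t%:Z)) (b - v + p i).
    apply: (lexD _ _ (- p i)).1; rewrite addrK.
    by apply: (lexD _ _ v).1; rewrite subrK -e; exact: lexp.
  have [e'|lab] := nextp _ _ Sb lb; first by rewrite -/a in e'; rewrite -e' addrK subrK.
  case: (lex_asym lba).
  apply: (lexD _ _ (- v)).1; rewrite addrK.
  by apply: (lexD _ _ (p i)).1; rewrite subrK.
move=> t tn; rewrite -!addz_succ !sync ?(ltnW tn) // !add0r.
congr pair; last by rewrite hx ?subrK ?magp // ltnW.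
by rewrite opprD addrACA subrr addr0 opprB addrA subrK.
Qed.
End Highway.

(** * Cluster fractals *)

Section Fractal.
Variables (Sigma : finType) (o : Sigma).
Implicit Types (x y z : config Sigma).

Definition conn r y u v := exists2 s, chain r (csupp o y) u s & last u s = v.

Lemma conn_refl r y u : y u <> o -> conn r y u u.
Proof. by move=> yu; exists [::] => //; split=> // w; rewrite inE => /eqP->. Qed.

Lemma conn_sym r y u v : conn r y u v -> conn r y v u.
Proof. by move=> [s ch <-]; have [s' ch' e] := chain_rev ch; exists s'. Qed.

Lemma conn_trans r y u v w : conn r y u v -> conn r y v w -> conn r y u w.
Proof.
move=> [s [p1 h1] e1] [t [p2 h2] e2]; exists (s ++ t); last by rewrite last_cat e1.
split; first by rewrite cat_path p1 e1.
move=> a; rewrite -cat_cons mem_cat => /orP[/h1//|ha].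
by apply: h2; rewrite inE ha orbT.
Qed.

Lemma conn_supp r y u v : conn r y u v -> y u <> o /\ y v <> o.
Proof.
by move=> [s [_ h] <-]; split; apply: h; [rewrite inE eqxx|exact: mem_last].
Qed.

Lemma conn_one r y u v : y u <> o -> y v <> o -> (dist u v <= r)%N -> conn r y u v.
Proof.
move=> yu yv d; exists [:: v] => //; split; first by rewrite /= d.
by move=> w; rewrite !inE => /orP[] /eqP->.
Qed.

Lemma conn_le r r' y u v : (r <= r')%N -> conn r y u v -> conn r' y u v.
Proof.
move=> le [s [p h] e]; exists s => //; split=> //.
by apply: sub_path p => a b /leq_trans; apply.
Qed.

Definition comp r y u : set cell := [set v | conn r y u v].

(** Clusters and the gluings of clusters are both of this form, so domains and
    supports are computed once for both. *)
Definition cut r (S : set cell) y : pattern Sigma :=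
  fun w => if `[< nbhd r S w >] then Some (y w : Sigma) else None.

Definition clus r y c : pattern Sigma := cut r (comp r y c) y.

Lemma cutE r S y w : nbhd r S w -> cut r S y w = Some (y w : Sigma).
Proof. by move=> h; rewrite /cut asboolT. Qed.

Lemma cutN r S y w : ~ nbhd r S w -> cut r S y w = None.
Proof. by move=> h; rewrite /cut asboolF. Qed.

Lemma pdom_cut r S y : pdom (cut r S y) = nbhd r S.
Proof.
apply/seteqP; split=> w; rewrite /pdom /=; last by move=> /cutE->.
by have [//|/cutN->] := pselect (nbhd r S w).
Qed.

Lemma nbhd_self r S : S `<=` nbhd r S.
Proof. by move=> u Su; exists u => //; rewrite /dist !subrr. Qed.

Lemma nbhd_le r r' S : (r <= r')%N -> nbhd r S `<=` nbhd r' S.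
Proof. by move=> le u [w Sw d]; exists w => //; exact: leq_trans le. Qed.

Lemma comp_isolated r r' y c w : (r <= r')%N -> nbhd r (comp r' y c) w -> y w <> o ->
  comp r' y c w.
Proof.
move=> le [a ca d] yw; apply: (conn_trans ca); apply: conn_one => //.
  by case: (conn_supp ca).
by rewrite distC; exact: leq_trans le.
Qed.

Lemma psupp_cut r r' y c : (r <= r')%N -> psupp o (cut r (comp r' y c) y) = comp r' y c.
Proof.
move=> le; apply/seteqP; split=> w.
  move=> [a]; have [h|/cutN->//] := pselect (nbhd r (comp r' y c) w).
  by rewrite cutE // => -[<-]; exact: (comp_isolated le h).
move=> h; exists (y w); last by case: (conn_supp h).
by apply: cutE; exact: nbhd_self.
Qed.

Lemma rcluster_clus r y c : y c <> o -> rcluster o r (clus r y c).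
Proof.
move=> yc; rewrite /rcluster /padded psupp_cut // pdom_cut; split=> //.
- by exists c; exact: conn_refl.
- move=> u v cu cv; have [s ch e] := conn_trans (conn_sym cu) cv.
  exists s; split=> //; first by case: ch.
  move=> w ws; apply: conn_trans cu _.
  by have [|s1 ch1 e1] := chain_prefix (w := w) ch; [rewrite inE ws orbT|exists s1].
- move=> u e; have : pdom (clus r y c) u by rewrite /pdom /= e.
  by rewrite pdom_cut.
Qed.

Lemma conn_shift r y u v w : conn r (shiftc v y) u w <-> conn r y (u + v) (w + v).
Proof.
split=> [[s ch <-]|[s ch e]].
  have := chain_shift (- v) ch; rewrite opprK => ch'.
  exists [seq a + v | a <- s]; last by rewrite (last_map (fun a => a + v)).
  apply: (chain_sub ch') => a ha; have [_ /(_ a ha)] := ch'.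
  by rewrite /csupp /= /shiftc subrK.
exists [seq a - v | a <- s]; last first.
  by rewrite -{1}(addrK v u) (last_map (fun a => a - v)) e addrK.
by have := chain_shift v ch; rewrite addrK.
Qed.

Lemma clus_translate r y v : translate v (clus r (shiftc v y) 0) = clus r y v.
Proof.
apply/funext => w; rewrite /translate.
have H : nbhd r (comp r (shiftc v y) 0) (w - v) <-> nbhd r (comp r y v) w.
  split=> [[a ca d]|[a ca d]].
    exists (a + v); last by cells.
    by move: ca; rewrite /comp /= conn_shift add0r.
  exists (a - v); last by cells.
  by rewrite /comp /= conn_shift add0r subrK.
have [h|h] := pselect (nbhd r (comp r y v) w).
  by rewrite /clus !cutE //; [rewrite /shiftc subrK|apply/H].
by rewrite /clus !cutN // => /H.
Qed.

Lemma clus_sub r r' y c v : (r <= r')%N -> conn r' y c v ->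
  contains (clus r' y c) (clus r y v).
Proof.
move=> le cv u; rewrite pdom_cut => h; rewrite /clus !cutE //.
move: h => [a ca d]; exists a; last exact: leq_trans le.
exact: conn_trans cv (conn_le le ca).
Qed.

Lemma zero_padding_cut r r' y c : (r <= r')%N ->
  zero_padding o r' (cut r (comp r' y c) y) = clus r' y c.
Proof.
move=> le; apply/funext => w; rewrite /zero_padding psupp_cut //.
have [h|h] := pselect (nbhd r (comp r' y c) w).
  by rewrite cutE // /clus cutE //; exact: nbhd_le h.
rewrite cutN // /clus /cut; case: asboolP => // h'; congr Some.
apply: contrapT => yw; apply: h; apply: nbhd_self.
by apply: (comp_isolated (leqnn r')) => //; exact: nesym.
Qed.

Section Bounded.
Variable X : set (config Sigma).
Hypothesis X_min : almost_minimal o X.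
Let closedX : closed X. Proof. by case: X_min => -[]. Qed.

Definition comp_bound r D := forall y u v, X y -> conn r y u v -> (dist u v <= D)%N.

Lemma comp_agree_sub r D y z : comp_bound r D -> X y -> agree D y z ->
  comp r y 0 `<=` comp r z 0.
Proof.
move=> bD Xy ag w [s ch <-]; exists s => //; apply: (chain_sub ch) => a ha.
have [s1 ch1 e1] := chain_prefix ch ha.
have h : (mag a <= D)%N by rewrite distC; apply: (bD y) => //; exists s1.
by rewrite /csupp /= -ag //; case: ch => _; apply.
Qed.

(** Since a component is contained in a ball of radius [D], clusters are
    determined by a finite window. *)
Lemma clus_agree r D y z : comp_bound r D -> X y -> X z -> agree (D + r) y z ->
  clus r y 0 = clus r z 0.
Proof.
move=> bD Xy Xz ag; have agD : agree D y z by apply: agree_le ag; exact: leq_addr.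
have e : comp r y 0 = comp r z 0.
  by apply/seteqP; split; apply: comp_agree_sub bD _ _ => //; exact: agree_sym.
rewrite /clus e; apply/funext => w.
have [h|h] := pselect (nbhd r (comp r z 0) w); last by rewrite !cutN.
rewrite !cutE //; congr Some; apply: ag; move: h => [a ca d].
by have h := bD _ _ _ Xz ca; cells.
Qed.

Lemma finite_box m : finite_set [set u | (mag u <= m)%N].
Proof.
apply/finite_seqP; exists (box m).
by apply/seteqP; split=> u /=; rewrite mem_box.
Qed.

Lemma finite_clus r D y : comp_bound r D -> X y -> finite_set (pdom (clus r y 0)).
Proof.
move=> bD Xy; apply: sub_finite_set (finite_box (D + r)) => w.
by rewrite pdom_cut => -[a ca d] /=; have h := bD _ _ _ Xy ca; cells.
Qed.

(** There are finitely many windows, and each determines its cluster. *)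
Lemma finite_clusters r D : comp_bound r D ->
  finite_set [set P | exists y, [/\ X y, y 0 <> o & P = clus r y 0]].
Proof.
move=> bD; pose b := in_tuple (box (D + r)).
have /choice[g hg] : forall t : (size (box (D + r))).-tuple Sigma, exists P,
    forall y, X y -> map_tuple (y : cell -> Sigma) b = t -> clus r y 0 = P.
  move=> t; have [[y Xy e]|h] :=
    pselect (exists2 y : config Sigma, X y & map_tuple (y : cell -> Sigma) b = t).
    exists (clus r y 0) => z Xz; rewrite -e => /(congr1 val) /= /eq_in_map ez.
    apply: clus_agree bD _ _ _ => // u hu; apply: ez.
    by rewrite mem_box.
  by exists (clus r (zero_config o) 0) => y Xy e; case: h; exists y.
apply: (@sub_finite_set _ _ (g @` setT)).
  by move=> P [y [Xy y0 ->]]; exists (map_tuple (y : cell -> Sigma) b) => //; exact/esym/hg.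
by apply: finite_image; exact: finite_finset.
Qed.

Hypothesis bounded : forall r, exists D, comp_bound r D.
Hypothesis infinite : forall y, X y -> y 0 <> o -> ~ finite_set (csupp o y).

(** Otherwise a limit would be a nonzero point supported in a ball. *)
Lemma escape D : exists R, forall z, X z -> z 0 <> o ->
  exists v, [/\ z v <> o, (D < mag v)%N & (mag v <= R)%N].
Proof.
apply: contrapT => /forallNP H.
have /choice[z hz] : forall R, exists z, [/\ X z, z 0 <> o &
    forall v, z v <> o -> (mag v <= R)%N -> (mag v <= D)%N].
  move=> R; apply: contrapT => h; apply: (H R) => z Xz z0.
  apply: contrapT => h2; apply: h; exists z; split=> // v zv vR.
  by rewrite leqNgt; apply/negP => lt; apply: h2; exists v.
have [|y Xy hy] := cluster_agree closedX (z := z); first by move=> n; case: (hz n).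
have y0 : y 0 <> o.
  by have [n _ /(_ 0)->] := hy 0%N 0%N; first case: (hz n).
apply: (infinite Xy y0); apply: (@sub_finite_set _ _ _ _ (finite_box D)) => v yv /=.
have [n vn /(_ v (leqnn _)) e] := hy (mag v) (mag v).
by have [_ _ h] := hz n; apply: h => //; rewrite -e.
Qed.

(** Every [r]-cluster occurs near every nonzero cell, and a nonzero cell outside
    the [r]-component of [0] is also found near [0]; when [r'] exceeds both
    distances, a single step connects [0] to these cells. *)
Lemma growth r : exists r', (r < r')%N /\ forall z, X z -> z 0 <> o ->
  (forall y, X y -> y 0 <> o -> exists2 v, conn r' z 0 v &
     translate v (clus r y 0) = clus r z v) /\
  exists2 v, conn r' z 0 v & ~ conn r z 0 v.
Proof.
have [D bD] := bounded r; have [R hR] := syndetic X_min (D + r).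
have [R2 hR2] := escape D.
exists (r + R + R2).+1; split=> [|z Xz z0]; first by rewrite ltnS -addnA leq_addr.
split.
  move=> y Xy y0; have [v dv hv] := hR y z 0 Xy Xz z0.
  exists v.
    apply: conn_one => //; first by have := hv 0; rewrite add0r => ->.
    by rewrite distC; apply: leq_trans dv _; lia.
  rewrite -(clus_translate r z v); congr (translate v _).
  apply: clus_agree bD Xy (shiftX X_min v Xz) _ => w hw.
  by rewrite /shiftc hv.
have [v [zv vD vR]] := hR2 z Xz z0; exists v.
  by apply: conn_one => //; rewrite distC; apply: leq_trans vR _; lia.
by move=> /(bD _ _ _ Xz); rewrite distC leqNgt vD.
Qed.

(** The pieces are the [r]-components inside the [r']-component of [0], which
    are indexed by one representative each, since a cluster glued with itself
    does not form a zero-gluing. *)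
Lemma decompose r r' z : (r <= r')%N -> X z -> z 0 <> o ->
  exists (n : nat) (v : 'I_n -> cell), [/\ forall k, z (v k) <> o &
   zero_gluing o (fun k => clus r z (v k)) (cut r (comp r' z 0) z)].
Proof.
move=> le Xz z0; have [D bD] := bounded r'.
pose C := comp r' z 0.
pose cs := [seq u <- box D | `[< C u >]].
have csP u : u \in cs <-> C u.
  rewrite mem_filter; split=> [/andP[/asboolP//]|Cu].
  apply/andP; split; first exact/asboolP.
  by rewrite mem_box distC; exact: bD Cu.
(* The first cell of the list in the component of [u]. *)
pose rep u := nth 0 cs (find (fun w => `[< conn r z u w >]) cs).
have repP u : C u -> C (rep u) /\ conn r z u (rep u).
  move=> Cu; have h : has (fun w => `[< conn r z u w >]) cs.
    apply/hasP; exists u; first exact/csP.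
    by apply/asboolP/conn_refl; case: (conn_supp Cu).
  split; first by apply/csP; rewrite mem_nth // -has_find.
  by apply/asboolP; exact: (nth_find 0 h).
have rep_eq u v : conn r z u v -> rep u = rep v.
  move=> uv; congr nth; apply: eq_find => w; apply/asboolP/asboolP.
    by move=> h; apply: conn_trans (conn_sym uv) h.
  by move=> h; apply: conn_trans uv h.
pose reps := undup (map rep cs).
have repsP u : u \in reps -> C u /\ rep u = u.
  rewrite mem_undup => /mapP[a /csP Ca ->]; have [h1 h2] := repP a Ca.
  by split=> //; rewrite -(rep_eq _ _ h2).
exists (size reps), (fun k => nth 0 reps k).
have Rk (k : 'I_(size reps)) : nth 0 reps k \in reps by rewrite mem_nth.
split.
  by move=> k; have [/conn_supp[]] := repsP _ (Rk k).
split.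
- rewrite pdom_cut; apply/seteqP; split=> w.
    move=> [a Ca d]; have [Cr cr] := repP a Ca.
    have ra : rep a \in reps by rewrite mem_undup; apply: map_f; exact/csP.
    have lt : (index (rep a) reps < size reps)%N by rewrite index_mem.
    exists (Ordinal lt) => //; rewrite pdom_cut /= nth_index //.
    by exists a => //; exact: conn_sym.
  move=> [k _]; rewrite pdom_cut => -[a ca d]; exists a => //.
  have [Ck _] := repsP _ (Rk k); exact: conn_trans Ck (conn_le le ca).
- move=> k u; rewrite pdom_cut => h; rewrite /clus !cutE //.
  move: h => [a ca d]; exists a => //.
  have [Ck _] := repsP _ (Rk k); exact: conn_trans Ck (conn_le le ca).
- move=> k l kl u; rewrite !pdom_cut => hk hl; rewrite /clus !cutE //.
  have -> : z u = o; last by [].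
  apply: contrapT => zu; apply: kl; apply: val_inj => /=.
  have ck := comp_isolated (leqnn r) hk zu.
  have cl := comp_isolated (leqnn r) hl zu.
  have := rep_eq _ _ (conn_trans ck (conn_sym cl)).
  have [_ ->] := repsP _ (Rk k); have [_ ->] := repsP _ (Rk l).
  by move/eqP; rewrite nth_uniq ?undup_uniq // => /eqP.
Qed.

(** The radii iterate [growth], and level [i] consists of the clusters around
    [0] of all points of [X] that are nonzero there.  A nonzero cell of [x] at
    distance at most [r] from [0] is in the [r]-component of [0], so the clusters of
    [x] itself converge to [x]. *)
Lemma bounded_cluster_fractal x : X x -> x 0 <> o -> cluster_fractal o x.
Proof.
move=> Xx x0; split; first by move=> e; rewrite e in x0.
have /choice[F hF] := growth.
pose r i := iter i F 0%N.
pose B i := [set P | exists y, [/\ X y, y 0 <> o & P = clus (r i) y 0]].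
have rlt i : (r i < r i.+1)%N by case: (hF (r i)).
exists r, B; split=> //.
- move=> i; have [D bD] := bounded (r i); split; first exact: finite_clusters bD.
  by move=> P [y [Xy y0 ->]]; split; [exact: finite_clus bD Xy|exact: rcluster_clus].
- move=> i Q [z [Xz z0 ->]]; have [_ /(_ z Xz z0) [h1 [v cv nv]]] := hF (r i).
  have le := ltnW (rlt i); have zv := (conn_supp cv).2.
  split.
  + have [n [w [zw gl]]] := decompose le Xz z0.
    exists n, (fun k => clus (r i) (shiftc (w k) z) 0), w,
      (cut (r i) (comp (r i.+1) z 0) z); split.
    * move=> k; exists (shiftc (w k) z); split=> //; first exact: (shiftX X_min).
      by rewrite /shiftc add0r.
    * have -> : (fun k => translate (w k) (clus (r i) (shiftc (w k) z) 0)) =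
        (fun k => clus (r i) z (w k)) by apply/funext => k; rewrite clus_translate.
      exact: gl.
    * by rewrite zero_padding_cut.
  + move=> P [y [Xy y0 ->]]; have [a ca e] := h1 y Xy y0.
    by exists a; rewrite e; exact: clus_sub le ca.
  + exists (clus (r i) (shiftc 0 z) 0), (clus (r i) (shiftc v z) 0), 0, v.
    rewrite !clus_translate; split.
    * by split; [exists (shiftc 0 z)|exists (shiftc v z)]; split=> //;
        do ?[exact: (shiftX X_min)]; rewrite /shiftc add0r.
    * exact: clus_sub le (conn_refl _ z0).
    * exact: clus_sub le cv.
    * rewrite !psupp_cut //; apply/seteqP; split=> // a [c1 c2].
      by apply: nv; exact: conn_trans c1 (conn_sym c2).
- exists (fun=> 0), (fun j => clus (r j) x 0); split.
    by move=> j; exists x.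
  apply: cvg_agree => m; exists m => n mn u hu.
  rewrite /shiftc addr0 /fill.
  have [h|h] := pselect (nbhd (r n) (comp (r n) x 0) u).
    by rewrite /clus cutE.
  rewrite /clus cutN //=; apply/esym; apply: contrapT => xu; apply: h.
  apply: nbhd_self; apply: conn_one => //; rewrite distC.
  apply: leq_trans hu _; apply: leq_trans mn _.
  by elim: (n) => // k IH; exact: leq_ltn_trans IH (rlt k).
Qed.

End Bounded.
End Fractal.

(** * The trichotomy *)

Theorem theorem1p2 (Sigma : finType) (o : Sigma) (X : set (config Sigma))
    (X_almost_minimal : almost_minimal o X)
    (trace_sparse : sparse o (trace X)) :
  exists x : config Sigma,
    X = orbit_closure x /\
    (finite_point o x \/ highway o x \/ cluster_fractal o x).
Proof.
have [x0 Xx0 x00] := nonzeroX X_almost_minimal.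
have oc x : X x -> x 0 <> o -> X = orbit_closure x.
  by move=> Xx xo; apply/esym; exact: orbit_closureE X_almost_minimal _ _ Xx xo.
have [[r long]|short] := pselect (exists r, forall n : nat, exists y u s,
    [/\ X y, chain r (csupp o y) u s & (n < dist u (last u s))%N]).
  have [R bn] := bottlenecks X_almost_minimal trace_sparse r.
  have [x [Xx xo th]] := spine_exists X_almost_minimal bn long.
  exists x; split; first exact: oc.
  right; left; apply: (spine_highway X_almost_minimal Xx xo).
    exact: (spine_width bn Xx th).
  exact: (spine_syndetic th).
have [[y [Xy yo fy]]|nf] := pselect (exists y, [/\ X y, y 0 <> o & finite_point o y]).
  by exists y; split; [exact: oc|left].
exists x0; split; first exact: oc.
right; right; apply: (bounded_cluster_fractal X_almost_minimal) Xx0 x00.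
- move=> r; apply: contrapT => h; apply: short; exists r => n.
  apply: contrapT => h2; apply: h; exists n => y u v Xy [s ch <-].
  by rewrite leqNgt; apply/negP => lt; apply: h2; exists y, u, s.
- by move=> y Xy yo fy; apply: nf; exists y.
Qed.
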